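(* Let $d\geq 2$ be an integer and let $k=\lfloor d/2\rfloor$. Then $p(U_d^k)$ is a vertex of $H_\infty^+(d,1)$ of degree (number of incident edges) $$\binom{d}{\lfloor d/2\rfloor}\geq\frac{2^d}{d+1}.$$ In particular, $H_\infty^+(d,1)$ has a vertex whose degree is exponential in the dimension $d$.
   Context: $G_d=\{0,1\}^d\setminus\{0\}\subset\mathbb{R}^d$ is the set of the $2^d-1$ non-zero $0/1$-valued $d$-dimensional vectors, called generators. For $S\subseteq G_d$, $p(S)=\sum_{g\in S}g$, with $p(\emptyset)=0$. The White Whale $H_\infty^+(d,1)$ is the zonotope $\mathrm{conv}\{p(S):S\subseteq G_d\}$, i.e. the Minkowski sum of the line segments between the origin and $g$, for $g\in G_d$. For $1\leq k\leq d-1$, $U_d^k$ denotes the set of all $0/1$-valued $d$-dimensional vectors whose last coordinate is equal to $1$ and that have at most $k$ non-zero coordinates. *)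

(* Defs.v *)
From mathcomp Require Import all_boot all_order all_algebra.
From mathcomp Require Import boolp classical_sets cardinality fsbigop reals convex.

Set Implicit Arguments.
Unset Strict Implicit.
Unset Printing Implicit Defensive.

Import Order.TTheory GRing.Theory Num.Theory.

Local Open Scope classical_set_scope.
Local Open Scope card_scope.
Local Open Scope ring_scope.

Section Polytopes.
Variables (R : realType) (d : nat).
Implicit Types (A P F : set 'rV[R]_d) (v : 'rV[R]_d).

Definition dot (c x : 'rV[R]_d) : R := \sum_(i < d) c ord0 i * x ord0 i.

Definition convex_hull A : set 'rV[R]_d :=
  smallest (fun C : set 'rV[R]_d => convex_set (C : set (convex_lmodType 'rV[R]_d))) A.

Definition affine_set A : Prop :=
  forall x y (t : R), A x -> A y -> A ((1 - t) *: x + t *: y).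

Definition affine_hull A : set 'rV[R]_d := smallest affine_set A.

(* The affine hull of A is x0 + W for a linear subspace W of dimension n, W
   being given as the row space of a matrix; the empty set has no dimension. *)
Definition has_dim A (n : nat) : Prop :=
  exists (x0 : 'rV[R]_d) (W : 'M[R]_d),
    \rank W = n /\ affine_hull A = [set x | (x - x0 <= W)%MS].

(* F is the set of maximizers over P of some linear functional (c = 0 gives P
   itself). *)
Definition is_face P F : Prop :=
  exists c : 'rV[R]_d,
    F = [set x | P x /\ forall y, P y -> dot c y <= dot c x].

Definition is_vertex P v : Prop := is_face P [set v].

Definition is_edge P F : Prop := is_face P F /\ has_dim F 1.

Definition has_degree P v (n : nat) : Prop :=
  [set F | is_edge P F /\ F v] #= `I_n.

End Polytopes.

Section WhiteWhale.
Variables (R : realType) (d : nat).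

Definition is01 (g : 'rV[R]_d) : Prop :=
  forall i, g ord0 i = 0 \/ g ord0 i = 1.

Definition generators : set 'rV[R]_d := [set g | is01 g /\ g <> 0].

(* A finitely supported sum over a set; equal to 0 when S is infinite; only
   subsets of the finite set of 0/1 vectors are used below. *)
Definition psum (S : set 'rV[R]_d) : 'rV[R]_d := \sum_(g \in S) g.

Definition white_whale : set 'rV[R]_d :=
  convex_hull [set psum S | S in [set S | S `<=` generators]].

(* The last coordinate is the one of index d - 1. *)
Definition Uset (k : nat) : set 'rV[R]_d :=
  [set g | [/\ is01 g,
               forall i : 'I_d, i.+1 = d -> g ord0 i = 1 &
               (#|[pred i : 'I_d | (g ord0 i != 0)%R]| <= k)%N]].

End WhiteWhale.

Arguments generators R d : clear implicits.
Arguments white_whale R d : clear implicits.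
Arguments Uset R d k : clear implicits.

(* Main.v *)
(* Write v for p(U_d^k) and, for a generator g, let g' be -g if g lies in U_d^k
   and g otherwise.  The zonotope is v plus the sum of the segments [0, g'], so
   the face of a functional c maximal at v (that is, nonpositive on every g') is
   v plus the sum of the [0, g'] with c(g') = 0.  Distinct generators are not
   collinear, so the edges at v are the segments [v, v + g'] such that some c
   vanishes at g' and is negative at all other signed generators.  The g with
   this property are those with last coordinate 1 and k or k + 1 nonzero
   coordinates, and a k-subset Q of the coordinates corresponds to the
   generator supported by Q together with the last coordinate. *)
Require Import Defs.
From mathcomp Require Import all_boot all_order all_algebra.
From mathcomp Require Import boolp classical_sets cardinality fsbigop.
From mathcomp Require Import reals interval_inference convex ring lra zify.
From mathcomp Require Import fintype finset.

Set Implicit Arguments.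
Unset Strict Implicit.
Unset Printing Implicit Defensive.

Import Order.TTheory GRing.Theory Num.Theory.

Local Open Scope classical_set_scope.
Local Open Scope ring_scope.

(** * 0/1 vectors as indicators of coordinate sets *)

Section Zonotope.
Variables (R : realType) (d : nat).
Implicit Types (A B : {set 'I_d}) (S : {set {set 'I_d}}) (c x : 'rV[R]_d).

Definition gen A : 'rV[R]_d := \row_j (j \in A)%:R.

Definition gsum S : 'rV[R]_d := \sum_(A in S) gen A.

Definition weight c A : R := \sum_(i in A) c ord0 i.

Lemma gen_inj : injective gen.
Proof.
move=> A B /rowP eAB; apply/setP => i; move: (eAB i); rewrite !mxE => /eqP.
by rewrite eqr_nat; case: (i \in A); case: (i \in B).
Qed.

Lemma gen01 A : is01 (gen A).
Proof. by move=> i; rewrite mxE; case: (i \in A); [right|left]. Qed.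

Lemma gen_eq0 A : (gen A == 0) = (A == set0).
Proof.
apply/eqP/eqP => [/rowP g0|->]; last by apply/rowP => i; rewrite !mxE inE.
apply/setP => i; have := g0 i; rewrite !mxE inE.
by case: (i \in A) => // /eqP; rewrite oner_eq0.
Qed.

Lemma is01P x : is01 x -> x = gen [set i | x ord0 i != 0]%SET.
Proof.
move=> x01; apply/rowP => i; rewrite mxE inE.
by case: (x01 i) => ->; rewrite ?eqxx ?oner_eq0.
Qed.

Lemma dotDr c x y : dot c (x + y) = dot c x + dot c y.
Proof. by rewrite -big_split; apply: eq_bigr => i _; rewrite mxE mulrDr. Qed.

Lemma dotZr c (a : R) x : dot c (a *: x) = a * dot c x.
Proof.
by rewrite /dot mulr_sumr; apply: eq_bigr => i _; rewrite mxE mulrCA.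
Qed.

Lemma dot_sum c (I : finType) (F : I -> 'rV[R]_d) :
  dot c (\sum_i F i) = \sum_i dot c (F i).
Proof.
rewrite /dot exchange_big; apply: eq_bigr => i _.
by rewrite summxE mulr_sumr.
Qed.

Lemma dot_gen c A : dot c (gen A) = weight c A.
Proof.
rewrite /weight big_mkcond; apply: eq_bigr => i _; rewrite mxE.
by case: (i \in A); rewrite ?mulr1 ?mulr0.
Qed.

Lemma psum_gen (D : set 'rV[R]_d) (S : {set {set 'I_d}}) :
  D = gen @` [set` S] -> psum D = gsum S.
Proof.
move=> ->; rewrite /psum fsbig_image; last by move=> ? ? _ _; exact: gen_inj.
have -> : [set` S] = [set` enum S].
  by apply/seteqP; split => A /=; rewrite mem_enum.
by rewrite -fsbig_seq ?enum_uniq// big_enum.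
Qed.

Lemma psum_generators (D : set 'rV[R]_d) : D `<=` generators R d ->
  psum D = gsum [set A | `[< D (gen A) >]]%SET.
Proof.
move=> Dg; apply: psum_gen; apply/seteqP; split => [x Dx /=|_ [A /= DA <-]].
  have [x01 _] := Dg _ Dx; exists [set i | x ord0 i != 0]%SET;
    last by rewrite -is01P.
  by rewrite /= inE -is01P//; exact/asboolP.
by move: DA; rewrite inE => /asboolP.
Qed.

(** * The zonotope as sums of generators with coefficients in [0, 1] *)

Definition unit_coef (t : {set 'I_d} -> R) := forall A, 0 <= t A <= 1.

(** A coefficient [t A] makes the point a convex combination, with weights [t A] and [1 - t A], of
    the points where it is replaced by 1 and by 0. Fixing all coefficients in turn ends at the
    points [gsum S]. *)
Lemma white_whale_gen t : unit_coef t ->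
  white_whale R d (\sum_A t A *: gen A).
Proof.
move=> t01 C [Cc Csub].
have CX S : C (gsum S).
  (* The empty set stands for the zero vector, which is not a generator; dropping it from [S] leaves
     the sum unchanged. *)
  apply: Csub; exists (gen @` [set` (S :\ set0)%SET]) => /=.
    move=> _ [A /= + <-]; rewrite !inE => /andP[A0 _].
    by split; [exact: gen01 | apply/eqP; rewrite gen_eq0].
  rewrite (psum_gen (S := (S :\ set0)%SET))// /gsum.
  have [S0|S0] := boolP (set0 \in S); last first.
    apply: eq_bigl => A; rewrite !inE.
    by case: eqP => // ->; rewrite (negbTE S0).
  by rewrite (big_setD1 _ S0)/= (eqP (_ : gen set0 == 0)) ?gen_eq0// add0r.
(* [s] lists the sets whose coefficient is still free, [S] holds those whose coefficient has been
   fixed at 1. *)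
suff H s S : uniq s -> {in s, forall A, A \notin S} ->
    C (\sum_(A <- s) t A *: gen A + gsum S).
  have := H (index_enum _) set0 (index_enum_uniq _).
  rewrite /gsum big_set0 addr0; apply => A _.
  by rewrite inE.
elim: s S => [|A s IH] S /=; first by rewrite big_nil add0r.
move=> /andP[As us] sS.
have AS : A \notin S by apply: sS; rewrite inE eqxx.
have sS' : {in s, forall B, B \notin S}.
  by move=> B Bs; apply: sS; rewrite inE Bs orbT.
have sSA : {in s, forall B, B \notin (A |: S)%SET}.
  by move=> B Bs; rewrite !inE negb_or sS'// andbT; apply: contraNneq As => <-.
have [tA0 tA1] := andP (t01 A).
have := Cc _ _ (Itv01 tA0 tA1) (mem_set (IH _ us sSA)) (mem_set (IH _ us sS')).
move=> /set_mem; congr C;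
  rewrite /conv /= /unstable.onem big_cons /gsum big_setU1//=.
by rewrite (addrCA _ (gen A)) scalerDr -!addrA -scalerDl (addrCA (t A)) subrr addr0 scale1r.
Qed.

Lemma white_whaleP x :
  white_whale R d x <-> exists2 t, unit_coef t & x = \sum_A t A *: gen A.
Proof.
split=> [|[t t01 ->]]; last exact: white_whale_gen.
apply: (smallest_sub (X := [set x | exists2 t, unit_coef t & x = \sum_A t A *: gen A])).
  move=> a b l /set_mem[s s01 ->] /set_mem[t t01 ->]; apply/mem_set => /=.
  exists (fun A => l%:num * s A + (1 - l%:num) * t A).
    move=> A; have := s01 A; have := t01 A.
    have : 0 <= l%:num by []. have : l%:num <= 1 by [].
    move: (l%:num) => r; nra.
  rewrite /conv /= /unstable.onem !scaler_sumr -big_split;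
    apply: eq_bigr => A _ /=.
  by rewrite !scalerA scalerDl.
move=> _ [D /= Dg <-]; rewrite psum_generators//.
set S := [set _ | _]%SET; exists (fun A => (A \in S)%:R).
  by move=> A; case: (A \in S); rewrite ?lexx ?ler01.
rewrite /gsum big_mkcond; apply: eq_bigr => A _.
by case: (A \in S); rewrite ?scale1r ?scale0r.
Qed.

(** * Recentring the zonotope at [gsum S] *)

Definition sgen S A : 'rV[R]_d := if A \in S then - gen A else gen A.

(* Substituting [1 - t A] for [t A] on S moves the origin of the zonotope to
   the point [gsum S]. *)
Lemma white_whale_sgen S x : white_whale R d x <->
  exists2 s, unit_coef s & x = gsum S + \sum_A s A *: sgen S A.
Proof.
pose flip (t : {set 'I_d} -> R) A := if A \in S then 1 - t A else t A.
have flip01 t : unit_coef t -> unit_coef (flip t).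
  move=> t01 A; have := t01 A; rewrite /flip; case: (A \in S) => //; lra.
have flipE t : gsum S + \sum_A flip t A *: sgen S A = \sum_A t A *: gen A.
  rewrite /gsum big_mkcond -big_split; apply: eq_bigr => A _.
  rewrite /= /flip /sgen; case: (A \in S); last by rewrite add0r.
  by rewrite scalerN scalerBl scale1r opprB addrC subrK.
have flipK t : flip (flip t) = t.
  apply: funext => A; rewrite /flip; case: (A \in S) => //.
  by rewrite opprB addrC subrK.
split=> [/white_whaleP[t t01 ->]|[s s01 ->]].
  by exists (flip t); [exact: flip01 | rewrite flipE].
apply/white_whaleP; exists (flip s); first exact: flip01.
by rewrite -flipE flipK.
Qed.

Definition segment S A : set 'rV[R]_d :=
  [set gsum S + r *: sgen S A | r in [set r | 0 <= r <= 1]].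

Lemma segment_gsum S A : segment S A (gsum S).
Proof. by exists 0; rewrite /= ?lexx ?ler01// scale0r addr0. Qed.

Lemma segment_end S A : segment S A (gsum S + sgen S A).
Proof. by exists 1; rewrite /= ?lexx ?ler01// scale1r. Qed.

Lemma sum_single A (r : R) (F : {set 'I_d} -> 'rV[R]_d) :
  \sum_B (if B == A then r else 0) *: F B = r *: F A.
Proof.
rewrite (bigD1 A)//= eqxx big1 ?addr0// => B /negbTE ->.
by rewrite scale0r.
Qed.

Lemma segment_sub S A : segment S A `<=` white_whale R d.
Proof.
move=> _ [r /= r01 <-]; apply/(white_whale_sgen S).
exists (fun B => if B == A then r else 0); last by rewrite sum_single.
by move=> B; case: eqP => // _; rewrite lexx ler01.
Qed.

(** * Faces containing [gsum S] *)

Definition maximizers c (P : set 'rV[R]_d) : set 'rV[R]_d :=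
  [set x | P x /\ forall y, P y -> dot c y <= dot c x].

Lemma dot_sgen_le0 S c : maximizers c (white_whale R d) (gsum S) ->
  forall A, dot c (sgen S A) <= 0.
Proof.
move=> [_ vmax] A; have := vmax _ (segment_sub (segment_end S A)).
by rewrite dotDr gerDl.
Qed.

Lemma maximizers_segment S c : (forall A, dot c (sgen S A) <= 0) ->
  forall A, dot c (sgen S A) = 0 ->
  segment S A `<=` maximizers c (white_whale R d).
Proof.
move=> c0 A cA x xA; split; first exact: segment_sub xA.
move: xA => [r _ <-] _ /(white_whale_sgen S)[s s01 ->].
rewrite !dotDr dotZr cA mulr0 lerD2l dot_sum sumr_le0// => B _.
by rewrite dotZr mulr_ge0_le0//; case/andP: (s01 B).
Qed.

(** The value of [c] at [x] exceeds its value at [gsum S] by a sum of nonpositive terms. Maximality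
    makes this sum nonnegative, so every term vanishes, and a negative direction must have
    coefficient 0. *)
Lemma maximizersP S c : (forall A, dot c (sgen S A) <= 0) ->
  forall x, maximizers c (white_whale R d) x ->
  exists s, [/\ unit_coef s, forall A, dot c (sgen S A) < 0 -> s A = 0 &
                x = gsum S + \sum_A s A *: sgen S A].
Proof.
move=> c0 x [/(white_whale_sgen S)[s s01 ->] xmax]; exists s; split=> // A cA.
have /xmax := segment_sub (segment_gsum S A).
rewrite dotDr lerDl dot_sum => sum_ge0.
have sB B : dot c (s B *: sgen S B) <= 0.
  by rewrite dotZr mulr_ge0_le0//; case/andP: (s01 B).
have sum0 : \sum_B - dot c (s B *: sgen S B) = 0.
  by apply: le_anti; rewrite sumrN oppr_le0 sum_ge0 oppr_ge0 sumr_le0.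
have := psumr_eq0P (fun B _ => _ : 0 <= - dot c (s B *: sgen S B)) sum0.
move=> /(_ _ A isT)/eqP; rewrite dotZr oppr_eq0 mulf_eq0 (lt_eqF cA) orbF.
by move=> H; apply/eqP/H => B; rewrite oppr_ge0.
Qed.

Lemma sgen_set0 S : sgen S set0 = 0.
Proof.
have /eqP g0 : gen set0 == 0 by rewrite gen_eq0.
by rewrite /sgen g0 oppr0; case: ifP.
Qed.

(** All coefficients of a maximizer vanish, except possibly that of the empty set, whose direction
    is the zero vector. *)
Lemma gsum_vertex S c :
  (forall A, A != set0 -> dot c (sgen S A) < 0) ->
  is_vertex (white_whale R d) (gsum S).
Proof.
move=> c_lt0.
have c0 A : dot c (sgen S A) <= 0.
  have [->|/c_lt0/ltW//] := eqVneq A set0.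
  by rewrite sgen_set0 -(scale0r 0) dotZr mul0r.
exists c; apply/seteqP; split=> [_ ->|x /(maximizersP c0)[s [_ s0 ->]]].
  apply: (maximizers_segment c0 _ (segment_gsum S set0)).
  by rewrite sgen_set0 -(scale0r 0) dotZr mul0r.
rewrite /= big1 ?addr0// => A _.
have [->|A0] := eqVneq A set0; first by rewrite sgen_set0 scaler0.
by rewrite s0 ?scale0r// c_lt0.
Qed.

Lemma maximizers_eq_segment S c A :
  (forall B, dot c (sgen S B) <= 0) -> dot c (sgen S A) = 0 ->
  (forall B, B != set0 -> B != A -> dot c (sgen S B) < 0) ->
  maximizers c (white_whale R d) = segment S A.
Proof.
move=> c0 cA cB; apply/seteqP; split; last exact: maximizers_segment.
move=> x /(maximizersP c0)[s [s01 s0 ->]]; exists (s A); first exact: s01.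
rewrite (bigD1 A)//= big1 ?addr0// => B BA.
have [->|B0] := eqVneq B set0; first by rewrite sgen_set0 scaler0.
by rewrite s0 ?scale0r// cB.
Qed.

(** * Edges at [gsum S] *)

(** The direction is wrapped in [<<_>>] because [has_dim] asks for a square matrix. *)
Lemma affine_hull_segment S A :
  affine_hull (segment S A) =
  [set x | (x - gsum S <= <<sgen S A>>)%MS].
Proof.
apply/seteqP; split.
  apply: smallest_sub => [x y t /= xA yA|_ [r _ <-]] /=.
    rewrite (_ : _ - _ = (1 - t) *: (x - gsum S) + t *: (y - gsum S)).
      by rewrite addmx_sub// scalemx_sub.
    rewrite !scalerBr addrACA -opprD -scalerDl (_ : 1 - t + t = 1) ?scale1r//.
    by rewrite subrK.
  by rewrite addrAC subrr add0r genmxE scalemx_sub.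
(* A point of the line is an affine combination of the two ends of the segment. *)
move=> x /=; rewrite genmxE => /sub_rVP[a xE] C [Caff segC].
have := Caff _ _ a (segC _ (segment_gsum S A)) (segC _ (segment_end S A)).
congr C; rewrite scalerDr addrA -scalerDl subrK scale1r -xE addrC subrK//.
Qed.

Lemma rank_sgen S A : A != set0 -> \rank (sgen S A) = 1.
Proof.
by rewrite rank_rV /sgen; case: ifP => _ A0; rewrite ?oppr_eq0 gen_eq0 A0.
Qed.

Lemma segment_dim1 S A : A != set0 -> has_dim (segment S A) 1.
Proof.
move=> A0; exists (gsum S), <<sgen S A>>%MS.
by rewrite genmxE rank_sgen// affine_hull_segment.
Qed.

(* Two nonzero 0/1 vectors are collinear only if they are equal. *)
Lemma gen_collinear A B (a : R) : B != set0 ->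
  gen B = a *: gen A -> A = B.
Proof.
move=> B0 BA; suff a1 : a = 1 by apply: gen_inj; rewrite BA a1 scale1r.
have /set0Pn[i iB] := B0; have /rowP/(_ i) := BA.
rewrite !mxE iB; case: (i \in A); rewrite ?mulr1 ?mulr0 => // /eqP.
by rewrite oner_eq0.
Qed.

Lemma sgen_collinear S A B (a : R) : B != set0 ->
  sgen S B = a *: sgen S A -> A = B.
Proof.
move=> B0; rewrite /sgen; case: ifP; case: ifP => _ _ BA.
- by apply: (@gen_collinear _ _ a) => //; rewrite -[LHS]opprK BA scalerN opprK.
- by apply: (@gen_collinear _ _ (- a)) => //; rewrite -[LHS]opprK BA scaleNr.
- by apply: (@gen_collinear _ _ (- a)) => //; rewrite BA scalerN scaleNr.
- exact: gen_collinear BA.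
Qed.

Lemma segment_inj S A B : B != set0 -> segment S A = segment S B -> A = B.
Proof.
move=> B0 AB; have := segment_end S B; rewrite -AB => -[r _ /addrI rE].
exact: sgen_collinear (esym rE).
Qed.

(** Dimension 1 excludes both extremes: if no nonzero direction had value 0 the face would be a
    point, and two such directions would be collinear, hence equal. *)
Lemma edge_unique S c : maximizers c (white_whale R d) (gsum S) ->
  has_dim (maximizers c (white_whale R d)) 1 ->
  exists A, [/\ A != set0, dot c (sgen S A) = 0 &
    forall B, B != set0 -> B != A -> dot c (sgen S B) < 0].
Proof.
move=> vmax [x0 [W [W1 hullE]]]; have c0 := dot_sgen_le0 vmax.
have subW x y : affine_hull (maximizers c (white_whale R d)) x ->
    affine_hull (maximizers c (white_whale R d)) y -> (x - y <= W)%MS.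
  rewrite hullE /= => xW yW; rewrite -(subrKA x0) -[x0 - y]opprB.
  by rewrite addmx_sub ?eqmx_opp.
have vW : affine_hull (maximizers c (white_whale R d)) (gsum S).
  exact: sub_gen_smallest.
have [[A [A0 cA]]|noA] := pselect (exists A, A != set0 /\ dot c (sgen S A) = 0).
  exists A; split=> // B B0 BA; rewrite lt_neqAle c0 andbT.
  apply: contra BA => /eqP cB.
  have inW D : dot c (sgen S D) = 0 -> (sgen S D <= W)%MS.
    move=> cD; have := subW _ _ (sub_gen_smallest
      (maximizers_segment c0 cD (segment_end S D))) vW.
    by rewrite addrAC subrr add0r.
  (* [W] has rank 1 and contains the nonzero direction of [A], so it is spanned by it. *)
  have AW : (W <= sgen S A)%MS.
    by rewrite -(geq_leqif (mxrank_leqif_sup (inW _ cA))) W1 rank_sgen.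
  have /sub_rVP[a BE] := submx_trans (inW _ cB) AW.
  by apply/eqP/esym/(sgen_collinear B0 BE).
(* Without a direction of value 0 the face, hence its affine hull, is the single point [gsum S],
   whereas [W] contains a nonzero vector. *)
have maxE x : maximizers c (white_whale R d) x -> x = gsum S.
  move=> /(maximizersP c0)[s [_ s0 ->]]; rewrite big1 ?addr0// => A _.
  have [->|A0] := eqVneq A set0; first by rewrite sgen_set0 scaler0.
  rewrite s0 ?scale0r// lt_neqAle c0 andbT; apply/eqP => cA.
  by apply: noA; exists A.
have hull1 x : affine_hull (maximizers c (white_whale R d)) x -> x = gsum S.
  apply: (smallest_sub (X := [set gsum S])) => [y z t -> ->|y /maxE//].
  by rewrite -scalerDl subrK scale1r.
have W0 : W != 0 by rewrite -mxrank_eq0 W1.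
have /rowV0Pn[w wW w0] := W0.
have /hull1 : affine_hull (maximizers c (white_whale R d)) (gsum S + w).
  move: vW; rewrite hullE /= => vW.
  by rewrite addrAC addmx_sub.
by move/eqP; rewrite -subr_eq0 addrAC subrr add0r (negbTE w0).
Qed.

End Zonotope.

(** Passes from the cardinal of a finite set to equipotence: both sides are injective images of the
    ordinals below [#|D|]. *)
Lemma card_eq_finset (T : finType) (D : {set T}) :
  ([set` D] #= `I_#|D|)%card.
Proof.
have -> : [set` D] = (fun i : 'I_#|D| => enum_val i) @` [set: 'I_#|D|].
  apply/seteqP; split=> [x xD|_ [i _ <-]]; last exact: enum_valP.
  by exists (enum_rank_in (xD : x \in D) x); rewrite ?enum_rankK_in.
have -> : `I_#|D| = (fun i : 'I_#|D| => val i) @` [set: 'I_#|D|].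
  apply/seteqP; split=> [i iD|_ [i _ <-]]; last exact: ltn_ord.
  by exists (Ordinal iD).
apply: (card_eq_trans (B := [set: 'I_#|D|])).
  by apply: inj_card_eq => i j _ _; exact: enum_val_inj.
by apply/card_esym/inj_card_eq => i j _ _; exact: val_inj.
Qed.

(** * The family of supports of U_d^k for d = n + 1, and functionals adapted to it *)

Section DegreeOfUset.
Variables (R : realType) (n k : nat).
Hypotheses (k_gt0 : (0 < k)%N) (k_le_n : (k <= n)%N).
Implicit Types (A B T : {set 'I_n.+1}) (c : 'rV[R]_n.+1).

Local Notation last := (@ord_max n).

Definition uset : {set {set 'I_n.+1}} :=
  [set A : {set 'I_n.+1} | (last \in A) && (#|A| <= k)%N]%SET.

Lemma psum_Uset : psum (Uset R n.+1 k) = gsum R uset.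
Proof.
apply: psum_gen; apply/seteqP; split=> [x [x01 xlast xk]|_ [A /= + <-]].
  exists [set i | x ord0 i != 0]%SET; last by rewrite -is01P.
  by rewrite /= !inE xlast// oner_eq0 cardsE.
rewrite inE => /andP[lastA Ak]; split; first exact: gen01.
  move=> i [iE]; have -> : i = last by exact: val_inj.
  by rewrite mxE lastA.
rewrite (_ : #|_| = #|A|)//; apply: eq_card => i.
by rewrite !inE mxE pnatr_eq0 eqb0 negbK.
Qed.

Lemma dot_sgen c A :
  dot c (sgen R uset A) = if A \in uset then - weight c A else weight c A.
Proof.
rewrite /sgen -dot_gen; case: ifP => // _.
by rewrite -scaleN1r dotZr mulN1r.
Qed.

(** The parameters are naturals, so that the sign of a weight becomes a comparison of [z] with a
    natural combination of [x] and [y]. *)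
Definition witness T (x y z : nat) : 'rV[R]_n.+1 :=
  \row_i (if i == last then z%:R else if i \in T then - x%:R else - y%:R).

Lemma card_split T A : last \notin T ->
  #|A| = ((last \in A) + (#|A :&: T| + #|A :\: T :\ last|))%N.
Proof.
move=> lastT; rewrite -(cardsID T A) (cardsD1 last (A :\: T)) inE lastT /=.
by rewrite addnCA.
Qed.

Lemma weight_witness T x y z A : last \notin T ->
  weight (witness T x y z) A =
  ((last \in A) * z)%:R - (#|A :&: T| * x + #|A :\: T :\ last| * y)%:R.
Proof.
move=> lastT; have i_last i : i \in T -> (i == last) = false.
  by apply: contraTF => /eqP ->.
rewrite /weight (big_setID T)/= natrD !natrM opprD addrCA; congr (_ + _).
  rewrite (eq_bigr (fun=> - x%:R)).
    by rewrite sumr_const -(mulr_natl (- x%:R)) mulrN.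
  by move=> i /setIP[_ iT]; rewrite mxE i_last// iT.
have rest : \sum_(i in A :\: T :\ last) witness T x y z ord0 i =
    - (#|A :\: T :\ last|%:R * y%:R).
  rewrite (eq_bigr (fun=> - y%:R)).
    by rewrite sumr_const -(mulr_natl (- y%:R)) mulrN.
  by move=> i /setD1P[/negbTE il /setDP[_ /negbTE iT]]; rewrite mxE il iT.
have [lastA|lastA] := boolP (last \in A).
  by rewrite (big_setD1 last)/= ?inE ?lastT// rest mxE eqxx mul1r.
rewrite mul0r add0r -rest; apply: eq_bigl => i.
by rewrite !inE; case: eqP => // ->; rewrite (negbTE lastA) andbF.
Qed.

(** A set [A] lies in [uset] exactly when it contains [last] and [a + b < k], so [small] and [large]
    give the required sign when [last] is in [A]. Otherwise the weight is minus a positive number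
    and [A] is outside [uset]. *)
Lemma witness_sgen T x y z A : last \notin T ->
    let a := #|A :&: T| in let b := #|A :\: T :\ last| in
    (last \in A -> (a + b < k)%N -> (a * x + b * y < z)%N) ->
    (last \in A -> (k <= a + b)%N -> (z < a * x + b * y)%N) ->
    (0 < x)%N -> (0 < y)%N -> A != set0 ->
  dot (witness T x y z) (sgen R uset A) < 0.
Proof.
move=> lastT a b small large x0 y0 A0; rewrite dot_sgen weight_witness//.
rewrite inE (card_split A lastT) -/a -/b; case: ifPn => [/andP[lastA]|].
  by rewrite lastA mul1n add1n oppr_lt0 subr_gt0 ltr_nat; exact: small.
rewrite negb_and -ltnNge subr_lt0 ltr_nat.
have := card_split A lastT; rewrite -/a -/b => cA.
have : (0 < #|A|)%N by rewrite card_gt0.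
rewrite cA; case lastA : (last \in A) => /=; last by nia.
by rewrite mul1n add1n ltnS; move=> _; exact: large.
Qed.

Lemma uset_vertex : is_vertex (white_whale R n.+1) (gsum R uset).
Proof.
(* With [T] empty only [y = 2] matters: the odd number 2k - 1 separates 2b for b < k from 2b for b
   >= k. *)
apply: (gsum_vertex (c := witness set0 1 2 (k.*2.-1))) => A A0.
by apply: witness_sgen => //; rewrite ?inE// setI0 cards0 => _; lia.
Qed.

Lemma eq_setU1_last T A : last \notin T -> last \in A ->
  #|A :&: T| = #|T| -> #|A :\: T :\ last| = 0%N -> A = last |: T.
Proof.
move=> lastT lastA aT /eqP; rewrite cards_eq0 => /eqP b0.
have /eqP AT : A :&: T == T by rewrite eqEcard subsetIr aT leqnn.
apply/setP => i; have /setP/(_ i) := AT; have /setP/(_ i) := b0.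
by rewrite !inE; case: eqP => [->|_]; case: (i \in T); case: (i \in A).
Qed.

(** The value [#|T| * x] at [last] balances the entries [- x] on [T]. *)
Lemma witness_setU1 T x y : last \notin T ->
  dot (witness T x y (#|T| * x)) (sgen R uset (last |: T)) = 0.
Proof.
move=> lastT; suff w0 : weight (witness T x y (#|T| * x)) (last |: T) = 0.
  by rewrite dot_sgen w0 oppr0; case: ifP.
rewrite weight_witness// setU11 mul1n (setIidPr (subsetUr _ _)).
rewrite (_ : _ :\: _ :\ _ = set0) ?cards0 ?addn0 ?subrr//.
by apply/setP => i; rewrite !inE; case: eqP; case: (i \in T).
Qed.

(* The weights x and y of the entries inside and outside T differ just enough
   for [last |: T] to be the only set of weight 0. *)
Lemma segment_maximizers T : last \notin T -> (#|T| = k \/ #|T| = k.-1) ->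
  exists c, maximizers c (white_whale R n.+1) = @segment R _ uset (last |: T).
Proof.
move=> lastT cT.
(* If [#|T|] is k, then ak + b(k + 1) = (a + b)k + b is below k^2 for a + b < k, and for a + b >= k
   it equals k^2 only when a = k and b = 0. If [#|T|] is k - 1, then a(k + 1) + bk = (a + b)k + a is
   at least k^2 for a + b >= k, and for a + b < k it reaches k^2 - 1 only when a = k - 1 and b =
   0. *)
pose x := if #|T| == k then k else k.+1.
pose y := if #|T| == k then k.+1 else k.
exists (witness T x y (#|T| * x)).
have neg B : B != set0 -> B != last |: T ->
    dot (witness T x y (#|T| * x)) (sgen R uset B) < 0.
  move=> B0 BT;
    have aT : (#|B :&: T| <= #|T|)%N by rewrite subset_leq_card// subsetIr.
  have neq : last \in B -> ~ (#|B :&: T| = #|T| /\ #|B :\: T :\ last| = 0%N).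
    by move=> lastB [aE bE]; move/eqP: BT; apply; exact: eq_setU1_last.
  have xy0 : (0 < x)%N /\ (0 < y)%N by rewrite /x /y; case: ifP.
  case: xy0 => x0 y0; apply: witness_sgen => // lastB; move: aT (neq lastB).
    rewrite /x /y; case: cT => ->; rewrite ?eqxx ?ltn_eqF ?prednK//.
    - move: (#|B :&: T|) (#|_ :\ _|) => a b ak _ abk; nia.
    - move: (#|B :&: T|) (#|_ :\ _|) => a b ak ab abk.
      case: k k_gt0 ak ab abk => // j _ /= ak ab abk; have : (a < j)%N by lia.
      nia.
  rewrite /x /y; case: cT => ->; rewrite ?eqxx ?ltn_eqF ?prednK//.
  - move: (#|B :&: T|) (#|_ :\ _|) => a b ak ab abk; have : (0 < b)%N by lia.
    nia.
  - move: (#|B :&: T|) (#|_ :\ _|) => a b ak _ abk.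
    case: k k_gt0 ak abk => // j _ /= ak abk; nia.
apply: (maximizers_eq_segment _ (witness_setU1 _ _ lastT) neg).
move=> B; have [->|B0] := eqVneq B set0.
  by rewrite sgen_set0 -(scale0r 0) dotZr mul0r.
have [->|BT] := eqVneq B (last |: T); first by rewrite witness_setU1.
exact/ltW/neg.
Qed.

Lemma segment_edge T : last \notin T -> (#|T| = k \/ #|T| = k.-1) ->
  is_edge (white_whale R n.+1) (@segment R _ uset (last |: T)).
Proof.
move=> lastT cT; split.
  by have [c cE] := segment_maximizers lastT cT; exists c.
by apply: segment_dim1; apply/set0Pn; exists last; rewrite setU11.
Qed.

(** * Necessary condition on edge directions *)

(** All entries of [c] other than the last are negative, while [A] has weight 0. So adding an
    element to a too small [A] gives a member of [uset] of negative weight, and removing one from a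
    too large [A] gives a non-member of positive weight; both are impossible. *)
Lemma edge_set c A : maximizers c (white_whale R n.+1) (gsum R uset) ->
  A != set0 -> dot c (sgen R uset A) = 0 ->
  (forall B, B != set0 -> B != A -> dot c (sgen R uset B) < 0) ->
  last \in A /\ (#|A| = k \/ #|A| = k.+1).
Proof.
move=> vmax A0 cA cB; have c0 := dot_sgen_le0 vmax.
have w_in B : B \in uset -> 0 <= weight c B.
  by move=> BU; have := c0 B; rewrite dot_sgen BU oppr_le0.
have w_out B : B \notin uset -> weight c B <= 0.
  by move=> /negbTE BU; have := c0 B; rewrite dot_sgen BU.
have wA : weight c A = 0.
  by move: cA; rewrite dot_sgen; case: ifP => // _ /eqP;
    rewrite oppr_eq0 => /eqP.
have uniq_zero B : B != set0 -> weight c B = 0 -> B = A.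
  move=> B0 wB; apply/eqP; apply: contraT => /(cB _ B0).
  by rewrite dot_sgen wB oppr0; case: ifP; rewrite ltxx.
have wU1 i B : i \notin B -> weight c (i |: B) = c ord0 i + weight c B.
  by move=> iB; rewrite /weight big_setU1.
have wD1 i B : i \in B -> weight c B = c ord0 i + weight c (B :\ i).
  by move=> iB; rewrite /weight (big_setD1 i).
have no_last B : last \notin B -> B \notin uset by move=> lB;
  rewrite inE (negbTE lB).
have c_neg i : i != last -> c ord0 i < 0.
  move=> il;
    have wi : weight c [set i]%SET = c ord0 i by rewrite /weight big_set1.
  rewrite lt_neqAle -{2}wi w_out ?no_last ?inE 1?eq_sym// andbT.
  apply/eqP => /esym ci0.
  (* If the entry at [i] were 0, take k - 1 elements avoiding [i] and [last], available because k <=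
     n. Adding [last] gives a member of [uset], adding [i] as well a non-member of the same weight.
     Both weights are then 0, against the uniqueness of [A]. *)
  have : (0 < #|[set T : {set 'I_n.+1} | T \subset ~: [set i;
    last] & #|T| == k.-1]%SET|)%N.
    rewrite cards_draws bin_gt0 cardsCs setCK card_ord cards2 il.
    by lia.
  case/card_gt0P => T; rewrite inE => /andP[TC /eqP cT].
  have iT : i \notin T.
    by apply/negP => /(subsetP TC); rewrite !inE eqxx.
  have lT : last \notin T.
    by apply/negP => /(subsetP TC); rewrite !inE eqxx orbT.
  have iX : i \notin (last |: T)%SET by rewrite !inE negb_or il.
  have wX : weight c (last |: T) = 0.
    apply: le_anti; rewrite w_in ?andbT;
      last by rewrite !inE eqxx cardsU1 lT cT; lia.
    have := w_out (i |: (last |: T))%SET; rewrite wU1// ci0 add0r; apply.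
    by rewrite !inE eqxx orbT cardsU1 iX cardsU1 lT cT; lia.
  have XA : last |: T = A.
    by apply: uniq_zero => //; apply/set0Pn; exists last; rewrite setU11.
  have iXA : i |: (last |: T) = A.
    apply: uniq_zero; first by apply/set0Pn; exists i; rewrite setU11.
    by rewrite wU1// ci0 add0r.
  by move: iX; rewrite XA -iXA setU11.
have lastA : last \in A.
  apply: contraT => lA; have /set0Pn[i iA] := A0.
  have il : i != last by apply: contraNneq lA => <-.
  have wAi : weight c (A :\ i) <= 0.
    by apply/w_out/no_last; rewrite inE (negbTE lA) andbF.
  suff : weight c A < 0 by rewrite wA ltxx.
  by rewrite (wD1 i)// ltr_wnDr// c_neg.
split=> //.
have Agek : (k <= #|A|)%N.
  rewrite leqNgt; apply/negP => Ak.
  have /set0Pn[i] : ~: A != set0 by rewrite -card_gt0 cardsCs setCK card_ord;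
    lia.
  rewrite inE => iA; have il : i != last by apply: contraNneq iA => ->.
  have := w_in (i |: A)%SET;
    rewrite inE inE lastA orbT cardsU1 iA add1n Ak => /(_ isT).
  by rewrite wU1// wA addr0 leNgt c_neg.
have Alek : (#|A| <= k.+1)%N.
  rewrite leqNgt; apply/negP => Ak.
  have /set0Pn[i] : A :\ last != set0.
    by rewrite -card_gt0; move: Ak; rewrite (cardsD1 last) lastA ltnS;
      apply: leq_trans.
  rewrite !inE => /andP[il iA].
  have := w_out (A :\ i); rewrite !inE eq_sym il lastA.
  move: Ak; rewrite (cardsD1 i) iA add1n ltnS ltnNge /= => Ak /(_ Ak) wAi.
  suff : weight c A < 0 by rewrite wA ltxx.
  by rewrite (wD1 i)// ltr_wnDr// c_neg.
lia.
Qed.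

(** * Counting the edges by k-subsets *)

(** Since [P] and [Q] have the same size, the size of the union tells whether [last] was already
    present. *)
Lemma setU1_last_inj :
  {in [set Q : {set 'I_n.+1} | #|Q| == k]%SET &, injective (fun Q => last |: Q)%SET}.
Proof.
move=> P Q; rewrite !inE => /eqP cP /eqP cQ PQ.
have lPQ : (last \in P) = (last \in Q).
  have : #|last |: P| = #|last |: Q| by rewrite PQ.
  by rewrite !cardsU1 cP cQ => /addIn; case: (last \in P); case: (last \in Q).
apply/setP => i; have /setP/(_ i) := PQ; rewrite !inE.
by case: eqP => [->|].
Qed.

Lemma uset_degree : has_degree (white_whale R n.+1) (gsum R uset) 'C(n.+1, k).
Proof.
pose D := [set Q : {set 'I_n.+1} | #|Q| == k]%SET.
pose edge Q := @segment R _ uset (last |: Q)%SET.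
have -> : 'C(n.+1, k) = #|D| by rewrite card_draws card_ord.
rewrite /has_degree (_ : [set F | _] = edge @` [set` D]).
  apply: card_eq_trans; first apply: inj_card_eq.
    move=> P Q /set_mem PD /set_mem QD /segment_inj.
    move=> /(_ _)/setU1_last_inj; apply=> //.
    by apply/set0Pn; exists last; rewrite setU11.
  exact: card_eq_finset.
apply/seteqP; split=> [F [[[c Fc] Fdim] Fv]|_ [Q /= QD <-]].
  move: Fdim Fv; rewrite /is_edge Fc => Fdim Fv.
  have [A [A0 cA cB]] := edge_unique Fv Fdim.
  have [lastA Ak] := edge_set Fv A0 cA cB.
  have FA := maximizers_eq_segment (dot_sgen_le0 Fv) cA cB.
  (* The k-subset giving the direction [A] is [A] itself if it has k elements, and [A] without
     [last] if it has k + 1. *)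
  have [Ak1|Ak1] := eqVneq #|A| k.
    exists A; first by rewrite /= inE Ak1.
    by rewrite /edge (setUidPr _) ?sub1set.
  exists (A :\ last); last by rewrite /edge setD1K.
  case: Ak Ak1 => [->|cA1 _]; first by rewrite eqxx.
  by move: cA1; rewrite (cardsD1 last) lastA add1n => -[cA1];
    rewrite /= inE cA1.
split; last exact: segment_gsum.
move: QD; rewrite inE => /eqP cQ.
have [lQ|lQ] := boolP (last \in Q); last by apply: segment_edge => //; left.
(* Removing [last] from [Q] leaves the direction unchanged and gives the case of a set of size k -
   1. *)
rewrite /edge -(setD1K lQ) setUA setUid.
apply: segment_edge; first by rewrite setD11.
by right; rewrite -cQ (cardsD1 last Q) lQ.
Qed.

End DegreeOfUset.

(** * Bounds on the central binomial coefficient *)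

(** Binomial coefficients increase up to the middle; the upper half follows by the symmetry between
    i and n - i. *)
Lemma leq_bin_half (n i : nat) : ('C(n, i) <= 'C(n, n %/ 2))%N.
Proof.
have incr j m : (j + m <= n %/ 2)%N -> ('C(n, j) <= 'C(n, j + m))%N.
  elim: m => [|m IH] jm; first by rewrite addn0.
  apply: leq_trans (IH _) _; first by lia.
  (* With i = j + m, (i + 1) C(n, i + 1) = (n - i) C(n, i), and i + 1 <= n - i below the middle. *)
  rewrite addnS -(leq_pmul2l (m := (j + m).+1))// mul_bin_left leq_mul2r.
  by apply/orP; right; lia.
have [i_le|i_gt] := leqP i (n %/ 2).
  by rewrite -(subnKC i_le); apply: incr; rewrite subnKC.
have [i_n|n_i] := leqP i n; last by rewrite bin_small.
rewrite -bin_sub// -(subnKC (m := n - i) (n := n %/ 2)); last by lia.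
by apply: incr; lia.
Qed.

(** 2^n is the sum of the n + 1 binomial coefficients, each at most the central one. *)
Lemma exp2n_leq_bin_half (n : nat) : (2 ^ n <= n.+1 * 'C(n, n %/ 2))%N.
Proof.
have -> : (2 ^ n = \sum_(i < n.+1) 'C(n, i))%N.
  by rewrite -[2%N]/(1 + 1)%N expnDn; apply: eq_bigr => i _;
    rewrite !exp1n !muln1.
rewrite -[X in (_ <= X * _)%N]card_ord -sum_nat_const.
by apply: leq_sum => i _; exact: leq_bin_half.
Qed.

Lemma exp2_div_le_bin_half (R : realType) (n : nat) :
  2 ^+ n / n.+1%:R <= 'C(n, n %/ 2)%:R :> R.
Proof.
rewrite ler_pdivrMr ?ltr0n// -natrX -natrM ler_nat mulnC.
exact: exp2n_leq_bin_half.
Qed.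

(* [2 ^ n / n.+1 >= (9 / 8) ^ n] because [(16 / 9) ^ n >= n + 1]. *)
Lemma exp_le_bin_half (R : realType) (n : nat) : (2 <= n)%N ->
  (9 / 8) ^+ n <= 'C(n, n %/ 2)%:R :> R.
Proof.
move=> n2; apply: le_trans (exp2_div_le_bin_half R n).
rewrite ler_pdivlMr ?ltr0n// (_ : 2 = 9 / 8 * (16 / 9)); last by field.
rewrite [leRHS]exprMn ler_pM2l ?exprn_gt0//.
(* The induction starts at 2, where 256/81 >= 3; the bound fails at 1. *)
case: n n2 => [|[|n]]// _; elim: n => [|n IH]; first by rewrite expr2; lra.
rewrite exprS -natr1; have : 3 <= n.+3%:R :> R by rewrite ler_nat.
move: IH; move: (_ ^+ _) (n.+3%:R) => y z; lra.
Qed.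

(** * The degree of the vertex and its exponential growth *)

Theorem corollary5p6 (R : realType) :
  (forall d : nat, (2 <= d)%N ->
     [/\ is_vertex (white_whale R d) (psum (Uset R d (d %/ 2)%N)),
         has_degree (white_whale R d) (psum (Uset R d (d %/ 2)%N))
           'C(d, (d %/ 2)%N) &
         (2 ^+ d / (d.+1)%:R <= ('C(d, (d %/ 2)%N))%:R :> R)])
  /\
  (exists2 c : R, 1 < c &
     forall d : nat, (2 <= d)%N ->
       exists (v : 'rV[R]_d) (n : nat),
         [/\ is_vertex (white_whale R d) v,
             has_degree (white_whale R d) v n &
             c ^+ d <= n%:R]).
Proof.
have vertex_degree d : (2 <= d)%N ->
    is_vertex (white_whale R d) (psum (Uset R d (d %/ 2)%N)) /\
    has_degree (white_whale R d) (psum (Uset R d (d %/ 2)%N)) 'C(d, (d %/ 2)%N).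
  (* Writing d as n + 1 provides a last coordinate; d >= 2 gives 1 <= k <= n. *)
  case: d => // n n1; have k0 : (0 < n.+1 %/ 2)%N by lia.
  have kn : (n.+1 %/ 2 <= n)%N by lia.
  rewrite psum_Uset; split; first exact: uset_vertex.
  exact: uset_degree.
split=> [d /vertex_degree[? ?]|]; first by split=> //;
  exact: exp2_div_le_bin_half.
exists (9 / 8) => [|d d2]; first by lra.
have [? ?] := vertex_degree d d2.
exists (psum (Uset R d (d %/ 2)%N)), 'C(d, (d %/ 2)%N); split=> //.
exact: exp_le_bin_half.
Qed.
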